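(* Consider exact TD-PMD with adaptive step sizes $\{\eta_k\}$, started from any $V^0\in\mathbb{R}^{|\mathcal{S}|}$ and any initial policy $\pi_0$. For each $k$ let $\tilde\pi_k$ be any policy with $\langle\tilde\pi_k(\cdot|s),Q^k(s,\cdot)\rangle=\max_a Q^k(s,a)$ for all $s$. Let $c>0$ be an arbitrary constant and assume $$\eta_k\ge \frac{\|D^{\tilde\pi_k}_{\pi_k}\|_\infty}{c\,\gamma^{2k+1}}\quad\text{for all }k .$$ Then for every positive integer $T$, $$\|V^*-V^T\|_\infty\le\gamma^T\Big[\|V^*-V^0\|_\infty+\frac{c}{1-\gamma}\Big],\qquad \|V^*-V^{\pi_T}\|_\infty\le\frac{2\gamma^{T-1}}{1-\gamma}\Big[\|V^*-V^0\|_\infty+\frac{c}{1-\gamma}\Big].$$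
   Context: MDP: $\mathcal{S},\mathcal{A}$ are finite nonempty sets (states, actions), $P(\cdot|s,a)$ is a transition kernel, $r:\mathcal{S}\times\mathcal{A}\to[0,1]$ is the reward, $\gamma\in(0,1)$. $\Delta(X)$ is the probability simplex on $X$. A policy $\pi$ assigns $\pi(\cdot|s)\in\Delta(\mathcal{A})$ to each $s$. $V^\pi(s)=\mathbb{E}[\sum_{t\ge0}\gamma^t r(s_t,a_t)\mid s_0=s,\pi]$ with $a_t\sim\pi(\cdot|s_t)$, $s_{t+1}\sim P(\cdot|s_t,a_t)$; $V^*(s)=\max_\pi V^\pi(s)$. The Bellman operator is $\mathcal{T}^\pi V(s)=\mathbb{E}_{a\sim\pi(\cdot|s),s'\sim P(\cdot|s,a)}[r(s,a)+\gamma V(s')]$. $\|\cdot\|_\infty$ is the max norm. Mirror map: $h$ is a convex function of Legendre type on $\mathbb{R}^{|\mathcal{A}|}$ with $\Delta(\mathcal{A})\subseteq\mathrm{dom}\,h$ and $\mathrm{rint}\,\mathrm{dom}\,h\cap\Delta(\mathcal{A})\ne\varnothing$. $D_h(p,p')=h(p)-h(p')-\langle\nabla h(p'),p-p'\rangle$. For policies $\pi,\pi'$ put $D^{\pi}_{\pi'}(s)=D_h(\pi(\cdot|s),\pi'(\cdot|s))$ and $\|D^\pi_{\pi'}\|_\infty=\max_s D^\pi_{\pi'}(s)$; for $p\in\Delta(\mathcal{A})$, $D^p_{\pi'}(s)=D_h(p,\pi'(\cdot|s))$. Initial policies satisfy $\pi_0(\cdot|s)\in\mathrm{rint}\,\mathrm{dom}\,h$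 for all $s$. Exact TD-PMD with step sizes $\eta_k>0$: given any $V^0\in\mathbb{R}^{|\mathcal{S}|}$ and $\pi_0$ ($V^0$ need not be $V^{\pi_0}$), for $k=0,1,2,\dots$ set $Q^k(s,a)=r(s,a)+\gamma\,\mathbb{E}_{s'\sim P(\cdot|s,a)}[V^k(s')]$; $\pi_{k+1}(\cdot|s)=\arg\max_{p\in\Delta(\mathcal{A})}\{\eta_k\langle p,Q^k(s,\cdot)\rangle-D^p_{\pi_k}(s)\}$ for every $s$; $V^{k+1}=\mathcal{T}^{\pi_{k+1}}V^k$. *)

(* Defs.v *)
From HB Require Import structures.
From mathcomp Require Import all_boot all_order all_algebra.
From mathcomp Require Import all_classical all_reals all_analysis.
From mathcomp Require Import lra.
Set Implicit Arguments.
Unset Strict Implicit.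
Unset Printing Implicit Defensive.
Import Order.TTheory GRing.Theory Num.Theory.
Import numFieldTopology.Exports numFieldNormedType.Exports.
Local Open Scope classical_set_scope.
Local Open Scope ring_scope.

(* On a nonempty finite type the supremum of the range is the maximum. *)
Definition maxf {R : realType} {T : finType} (f : T -> R) : R := sup (range f).

Definition maxnorm {R : realType} {T : finType} (f : T -> R) : R :=
  maxf (fun x => `|f x|).

Definition dotf {R : realType} {T : finType} (f g : T -> R) : R :=
  \sum_(x : T) f x * g x.

Definition simplex (R : realType) (T : finType) : set (T -> R) :=
  [set p | (forall x, 0 <= p x) /\ \sum_(x : T) p x = 1].
Arguments simplex : clear implicits.

Definition vec {R : realType} {T : finType} (p : T -> R) : 'rV[R]_#|T| :=
  \row_i p (enum_val i).

Section ConvexAnalysis.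
Context {R : realType} {n : nat}.
Implicit Types (C M : set 'rV[R]_n) (h : 'rV[R]_n -> \bar R).

Definition affine_set M : Prop :=
  forall x y (t : R), M x -> M y -> M ((1 - t) *: x + t *: y).

Definition aff_hull C : set 'rV[R]_n :=
  [set x | forall M, affine_set M -> C `<=` M -> M x].

Definition rint C : set 'rV[R]_n :=
  [set x | aff_hull C x /\ within (aff_hull C) (nbhs x) C].

Definition edom h : set 'rV[R]_n := [set x | (h x < +oo)%E].

Definition proper_fun h : Prop :=
  (forall x, h x != -oo%E) /\ edom h !=set0.

Definition econvex h : Prop :=
  forall (x y : 'rV[R]_n) (t : R), 0 < t < 1 ->
    (h (t *: x + (1 - t) *: y)%R <= t%:E * h x + (1 - t)%:E * h y)%E.

Definition strict_econvex_on C h : Prop :=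
  forall (x y : 'rV[R]_n) (t : R), C x -> C y -> x != y -> 0 < t < 1 ->
    (h (t *: x + (1 - t) *: y)%R < t%:E * h x + (1 - t)%:E * h y)%E.

(* Meaningful at interior points of the domain, where h is finite nearby. *)
Definition grad h (x : 'rV[R]_n) : 'rV[R]_n :=
  \row_i 'D_(delta_mx 0 i) (fine \o h) x.

(* The sequences in the last clause are those of the open set int (dom h)
   converging to one of its boundary points. *)
Definition essentially_smooth h : Prop :=
  [/\ (edom h)° !=set0,
      forall x, (edom h)° x -> differentiable (fine \o h) x
    & forall (x : nat -> 'rV[R]_n) (z : 'rV[R]_n),
        (forall i, (edom h)° (x i)) -> ~ (edom h)° z ->
        x i @[i --> \oo] --> z ->
        `|grad h (x i)| @[i --> \oo] --> +oo].

(* Legendre type in the sense of Rockafellar, Convex Analysis, section 26;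
   closedness of h is not part of that definition. *)
Definition legendre h : Prop :=
  [/\ proper_fun h, econvex h, essentially_smooth h
    & strict_econvex_on (edom h)° h].

(* D_h(p, q), for p in dom h (so that h p is finite) and q in rint (dom h). *)
Definition bregman h (p q : 'rV[R]_n) : R :=
  fine (h p) - fine (h q) - \sum_i grad h q 0 i * (p - q) 0 i.

End ConvexAnalysis.

Definition mirror_map {R : realType} {A : finType}
    (h : 'rV[R]_#|A| -> \bar R) : Prop :=
  [/\ legendre h,
      vec @` simplex R A `<=` edom h
    & rint (edom h) `&` vec @` simplex R A !=set0].

Record mdp (R : realType) (S A : finType) := MDP {
  trans : S -> A -> S -> R;
  reward : S -> A -> R;
  gamma : R;
  transP : forall s a, simplex R S (trans s a);
  reward01 : forall s a, 0 <= reward s a <= 1;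
  gamma01 : 0 < gamma < 1 }.

Record policy (R : realType) (S A : finType) := Policy {
  policy_fun :> S -> A -> R;
  policyP : forall s, simplex R A (policy_fun s) }.

Section MDP.
Context {R : realType} {S A : finType}.
Variable M : mdp R S A.
Implicit Types (pol : policy R S A) (V : S -> R).

(* A probability space carrying (s_t, a_t)_t with s_0 = s, a_t ~ pol(.|s_t) and
   s_{t+1} ~ P(.|s_t, a_t), given through its finite-dimensional laws. *)
Record trajectory pol (s : S) := Trajectory {
  traj_disp : measure_display;
  traj_space : measurableType traj_disp;
  traj_prob : probability traj_space R;
  traj_state : nat -> traj_space -> S;
  traj_action : nat -> traj_space -> A;
  traj_state_measurable : forall t x, measurable (traj_state t @^-1` [set x]);
  traj_action_measurable : forall t a, measurable (traj_action t @^-1` [set a]);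
  traj_law : forall (n : nat) (x : nat -> S) (a : nat -> A),
    traj_prob [set w | forall t, (t <= n)%N ->
                 traj_state t w = x t /\ traj_action t w = a t] =
    ((x 0%N == s)%:R * \prod_(t < n.+1) pol (x t) (a t)
       * \prod_(t < n) trans M (x t) (a t) (x t.+1))%:E }.

Arguments traj_disp {pol s} _.
Arguments traj_space {pol s} _.
Arguments traj_prob {pol s} _.
Arguments traj_state {pol s} _ _ _.
Arguments traj_action {pol s} _ _ _.

Definition discounted_return pol s (X : trajectory pol s) (w : traj_space X) : R :=
  limn (series (fun t =>
    gamma M ^+ t * reward M (traj_state X t w) (traj_action X t w))).
Arguments discounted_return {pol s} _ _.

Definition value pol s (X : trajectory pol s) : R :=
  fine ('E_(traj_prob X)[discounted_return X]).

Definition opt_value (X : forall pol s, trajectory pol s) (s : S) : R :=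
  sup (range (fun pol => value (X pol s))).

Definition qfun V (s : S) (a : A) : R :=
  reward M s a + gamma M * \sum_(s' : S) trans M s a s' * V s'.

Definition bellman pol V (s : S) : R :=
  \sum_(a : A) pol s a *
    \sum_(s' : S) trans M s a s' * (reward M s a + gamma M * V s').

End MDP.

Section TDPMD.
Context {R : realType} {S A : finType}.
Variables (M : mdp R S A) (h : 'rV[R]_#|A| -> \bar R).

Definition policy_div (p q : policy R S A) (s : S) : R :=
  bregman h (vec (p s)) (vec (q s)).

Definition is_argmax {T : Type} (D : set T) (f : T -> R) (x : T) : Prop :=
  D x /\ forall y, D y -> f y <= f x.

Record td_pmd (eta : nat -> R) (pol : nat -> policy R S A)
    (V : nat -> S -> R) : Prop := TdPmd {
  pmd_init : forall s, rint (edom h) (vec (pol 0%N s));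
  pmd_step : forall k, 0 < eta k;
  pmd_policy : forall k s,
    is_argmax (simplex R A)
      (fun p => eta k * dotf p (qfun M (V k) s)
                - bregman h (vec p) (vec (pol k s)))
      (pol k.+1 s);
  pmd_value : forall k s, V k.+1 s = bellman M (pol k.+1) (V k) s }.

End TDPMD.

Section Sampling.
Context {R : realType} {T : finType}.

(* The remaining lemmas show that [trajectory M pol s] is always inhabited: the
   chain is sampled from one uniform variable u by nested intervals, [slot w n]
   being the set of u whose first n samples are w 0, ..., w (n - 1). *)
Definition cdf (q : T -> R) (k : nat) : R := \sum_(y | (enum_rank y < k)%N) q y.

Definition cell (t0 : T) (q : T -> R) (v : R) : T :=
  odflt t0 [pick x | cdf q (enum_rank x) <= v < cdf q (enum_rank x).+1].

Lemma cdfS q x : cdf q (enum_rank x).+1 = cdf q (enum_rank x) + q x.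
Proof.
rewrite /cdf (bigD1 x)//= addrC; congr (_ + _).
apply: eq_bigl => y; rewrite ltnS leq_eqVlt; case: (eqVneq y x) => [->|yx].
  by rewrite eqxx ltnn.
rewrite andbT; case: eqP => // /ord_inj/enum_rank_inj yx'.
by rewrite yx' eqxx in yx.
Qed.

Lemma cdf0 q : cdf q 0 = 0. Proof. by rewrite /cdf big_pred0. Qed.

Lemma cdf_homo q j k : simplex R T q -> (j <= k)%N -> cdf q j <= cdf q k.
Proof.
move=> [q0 _] jk; rewrite /cdf big_mkcond [leRHS]big_mkcond/=.
apply: ler_sum => y _; case: ltnP => [yj|_]; first by rewrite (leq_trans yj jk).
by case: ifP.
Qed.

Lemma cdf_card q : simplex R T q -> cdf q #|T| = 1.
Proof. by move=> [_ <-]; apply: eq_bigl => y; rewrite ltn_ord. Qed.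

Lemma cdf_ge0 q k : simplex R T q -> 0 <= cdf q k.
Proof. by move=> qs; rewrite -(cdf0 q) cdf_homo. Qed.

Lemma cdf_le1 q (x : T) : simplex R T q -> cdf q (enum_rank x).+1 <= 1.
Proof. by move=> qs; rewrite -(cdf_card qs) cdf_homo// ltn_ord. Qed.

Lemma cellP t0 q v : simplex R T q -> 0 <= v < 1 ->
  cdf q (enum_rank (cell t0 q v)) <= v < cdf q (enum_rank (cell t0 q v)).+1.
Proof.
move=> qs /andP[v0 v1]; rewrite /cell; case: pickP => //= none.
have ex : exists k, v < cdf q k by exists #|T|; rewrite cdf_card.
case: (ex_minnP ex) => -[|k] vk kmin; first by rewrite cdf0 ltNge v0 in vk.
have kv : cdf q k <= v.
  by rewrite leNgt; apply/negP => /kmin; rewrite ltnn.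
have kT : (k < #|T|)%N.
  have : (k.+1 <= #|T|)%N by apply: kmin; rewrite cdf_card.
  by [].
have := none (enum_val (Ordinal kT)).
by rewrite enum_valK /= kv vk.
Qed.

Lemma cdf_inj q (x y : T) v : simplex R T q ->
  cdf q (enum_rank x) <= v < cdf q (enum_rank x).+1 ->
  cdf q (enum_rank y) <= v < cdf q (enum_rank y).+1 -> x = y.
Proof.
move=> qs /andP[xv vx] /andP[yv vy].
apply: enum_rank_inj; apply: val_inj => /=.
case: (ltngtP (enum_rank x) (enum_rank y)) => // lt.
- by have := cdf_homo qs lt; rewrite leNgt (le_lt_trans yv vx).
- by have := cdf_homo qs lt; rewrite leNgt (le_lt_trans xv vy).
Qed.

Variables (t0 : T) (mu0 : T -> R) (K : T -> T -> R).
Hypotheses (mu0P : simplex R T mu0) (KP : forall x, simplex R T (K x)).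

Definition kern (w : nat -> T) n := if n is n'.+1 then K (w n') else mu0.

Fixpoint len (w : nat -> T) n : R :=
  if n is n'.+1 then len w n' * kern w n' (w n') else 1.

Fixpoint lo (w : nat -> T) n : R :=
  if n is n'.+1 then lo w n' + len w n' * cdf (kern w n') (enum_rank (w n'))
  else 0.

Fixpoint run (u : R) n : (T -> R) * R * R :=
  if n is n'.+1 then
    let '(q, l, d) := run u n' in
    let x := cell t0 q ((u - l) / d) in
    (K x, l + d * cdf q (enum_rank x), d * q x)
  else (mu0, 0, 1).

Definition walk (u : R) n : T :=
  let '(q, l, d) := run u n in cell t0 q ((u - l) / d).

Definition slot w n : set R := `[lo w n, lo w n + len w n[.

Lemma runE u n : run u n = (kern (walk u) n, lo (walk u) n, len (walk u) n).
Proof.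
elim: n => [//|n IH] /=.
by rewrite IH (_ : cell _ _ _ = walk u n)// /walk IH.
Qed.

Lemma walkE u n : walk u n =
  cell t0 (kern (walk u) n) ((u - lo (walk u) n) / len (walk u) n).
Proof.
transitivity (let '(q, l, d) := run u n in cell t0 q ((u - l) / d)) => //.
by rewrite runE.
Qed.

Lemma kernP w n : simplex R T (kern w n).
Proof. by case: n => [|n]; [exact: mu0P|exact: KP]. Qed.

Lemma len_ge0 w n : 0 <= len w n.
Proof. by elim: n => [|n IH] //=; rewrite mulr_ge0//; case: (kernP w n). Qed.

Lemma slotS w n u : slot w n.+1 u <->
  slot w n u /\ let v := (u - lo w n) / len w n in
  cdf (kern w n) (enum_rank (w n)) <= v < cdf (kern w n) (enum_rank (w n)).+1.
Proof.
rewrite /slot /= !in_itv/= cdfS.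
set q := kern w n; set l := lo w n; set d := len w n.
have c0 : 0 <= cdf q (enum_rank (w n)) := cdf_ge0 _ (kernP w n).
have c1 := cdf_le1 (w n) (kernP w n); rewrite cdfS -/q in c1.
have d0 : 0 <= d := len_ge0 w n.
split.
- move=> /andP[h1 h2].
  have dp : 0 < d.
    rewrite lt_neqAle d0 andbT; apply/eqP => d00.
    by move: h1 h2; rewrite -d00 !mul0r; lra.
  rewrite ler_pdivlMr// ltr_pdivrMr//; split; apply/andP; split; nra.
- case=> /andP[h1 h2]; have dp : 0 < d by lra.
  rewrite ler_pdivlMr// ltr_pdivrMr// => /andP[h3 h4].
  by apply/andP; split; lra.
Qed.

Lemma slot_sub w n m u : (n <= m)%N -> slot w m u -> slot w n u.
Proof.
by move=> /subnK <-; elim: (m - n)%N => [//|k IH]; rewrite addSn => /slotS[/IH].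
Qed.

Lemma slot0 w u : slot w 0 u = (0 <= u < 1) :> Prop.
Proof. by rewrite /slot /= add0r in_itv. Qed.

Lemma slot_ratio w n u : slot w n u -> 0 <= (u - lo w n) / len w n < 1.
Proof.
rewrite /slot /= in_itv/= => /andP[h1 h2]; have dp : 0 < len w n by lra.
by rewrite ler_pdivlMr// ltr_pdivrMr//; apply/andP; split; lra.
Qed.

Lemma slot_walk u n : 0 <= u < 1 -> slot (walk u) n u.
Proof.
move=> u01; elim: n => [|n IH]; first by rewrite slot0.
apply/slotS; split => //=.
by have := cellP t0 (kernP (walk u) n) (slot_ratio IH); rewrite -walkE.
Qed.

Lemma slot_ext w w' n : (forall t, (t < n)%N -> w t = w' t) ->
  [/\ kern w n = kern w' n, lo w n = lo w' n & len w n = len w' n].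
Proof.
elim: n => [//|n IH] e.
have [|k l d] := IH; first by move=> t tn; apply: e; exact: ltnW.
by rewrite /= k l d e.
Qed.

Lemma slot_uniq w w' n u : slot w n u -> slot w' n u ->
  forall t, (t < n)%N -> w t = w' t.
Proof.
elim: n => [//|n IH] /slotS[sw cw] /slotS[sw' cw'] t.
have e := IH sw sw'; have [k l d] := slot_ext e.
rewrite ltnS leq_eqVlt => /predU1P[->|]; last exact: e.
move: cw cw' => /=; rewrite k l d => cw cw'.
exact: cdf_inj (kernP w' n) cw cw'.
Qed.

Lemma slot_prefix w n u : slot w n u <->
  0 <= u < 1 /\ forall t, (t < n)%N -> walk u t = w t.
Proof.
split=> [sw|[u01 e]].
- have u01 : 0 <= u < 1 by rewrite -(slot0 w); apply: slot_sub sw.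
  by split => //; apply: slot_uniq sw; exact: slot_walk.
- have [_ l d] := slot_ext e.
  by have := slot_walk n u01; rewrite /slot l d.
Qed.

Lemma measurable_slot w n : measurable (slot w n).
Proof. exact: measurable_itv. Qed.

Lemma measurable_walk t x : measurable ([set u : R | 0 <= u < 1] `&` walk^~ t @^-1` [set x]).
Proof.
pose ext (f : {ffun 'I_t.+1 -> T}) n := f (inord n).
rewrite (_ : _ `&` _ = \bigcup_(f in [set f | ext f t = x]) slot (ext f) t.+1).
  apply: fin_bigcup_measurable; first exact: finite_finset.
  by move=> f _; exact: measurable_slot.
apply/seteqP; split => [u [/= u01 ux]|u [f /= fx /slot_prefix[u01 e]]].
- pose f := [ffun i : 'I_t.+1 => walk u i].
  have fE j : (j < t.+1)%N -> ext f j = walk u j.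
    by move=> jt; rewrite /ext ffunE inordK.
  exists f => /=; first by rewrite fE.
  by apply/slot_prefix; split=> // j jt; rewrite fE.
- by split => //=; rewrite e.
Qed.

Lemma len_prod w n :
  len w n.+1 = mu0 (w 0%N) * \prod_(t < n) K (w t) (w t.+1).
Proof.
elim: n => [|n IH]; first by rewrite /= big_ord0 mul1r mulr1.
by rewrite big_ord_recr /= mulrA -IH.
Qed.

End Sampling.

Definition unit_unif (R : realType) :=
  mrestr (@lebesgue_measure R) (measurable_itv `[0%R, 1%R[).

HB.instance Definition _ (R : realType) := Measure.copy (@unit_unif R)
  (mrestr (@lebesgue_measure R) (measurable_itv `[0%R, 1%R[)).

Lemma unit_unif_setT (R : realType) : @unit_unif R setT = 1%E.
Proof.
rewrite /unit_unif /mrestr setTI lebesgue_measure_itv/= lte_fin ltr01.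
by rewrite -EFinB subr0.
Qed.

HB.instance Definition _ (R : realType) :=
  Measure_isProbability.Build _ _ _ (@unit_unif R) (@unit_unif_setT R).

Lemma trajectory_exists (R : realType) (S A : finType) (M : mdp R S A)
  (pol : policy R S A) (s : S) : inhabited (trajectory M pol s).
Proof.
have [a0 _] : exists a : A, true.
  apply: contrapT => noA; have [_] := policyP pol s.
  rewrite big1 => [|a _]; last by case: noA; exists a.
  by move/eqP; rewrite eq_sym oner_eq0.
pose T := (S * A)%type.
pose mu0 (x : T) : R := (x.1 == s)%:R * pol x.1 x.2.
pose K (x y : T) : R := trans M x.1 x.2 y.1 * pol y.1 y.2.
have pairsum (f : S -> R) : \sum_(y : T) f y.1 * pol y.1 y.2 = \sum_y f y.
  rewrite -(pair_bigA _ (fun y b => f y * pol y b))/=.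
  by apply: eq_bigr => y _; rewrite -mulr_sumr; case: (policyP pol y) => _ ->; rewrite mulr1.
have mu0P : simplex R T mu0.
  split=> [x|].
    by rewrite mulr_ge0 ?ler0n//; case: (policyP pol x.1).
  rewrite (pairsum (fun y => (y == s)%:R)) (bigD1 s)//= eqxx big1 ?addr0//.
  by move=> y /negPf ->.
have KP x : simplex R T (K x).
  split=> [y|].
    by rewrite mulr_ge0//; [case: (transP M x.1 x.2)|case: (policyP pol y.1)].
  by rewrite (pairsum (trans M x.1 x.2)); case: (transP M x.1 x.2).
pose t0 : T := (s, a0).
pose W t (u : R) : T := if 0 <= u < 1 then walk t0 mu0 K u t else t0.
have mI : measurable ([set u : R | 0 <= u < 1]).
  by rewrite -(set_itvco (0:R) 1); exact: measurable_itv.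
have mW t x : measurable (W t @^-1` [set x]).
  rewrite (_ : _ @^-1` _ =
    ([set u : R | 0 <= u < 1] `&` (walk t0 mu0 K)^~ t @^-1` [set x]) `|`
    (~` [set u : R | 0 <= u < 1] `&` [set _ | t0 = x])); last first.
    apply/seteqP; split => u; rewrite /W /=.
      by case: ifPn => u01 ux; [left|right].
    by case => [[-> //]|[/negP/negPf -> //]].
  apply: measurableU; first exact: measurable_walk.
  apply: measurableI; first exact: measurableC.
  have [->|ne] := eqVneq t0 x.
    by rewrite (_ : [set _ | _] = setT) //; apply/seteqP; split.
  rewrite (_ : [set _ | _] = set0) //; apply/seteqP; split => //= u /eqP.
  by rewrite (negPf ne).
have mW1 t x : measurable ((fun u => (W t u).1) @^-1` [set x]).
  rewrite (_ : _ @^-1` _ = \bigcup_(b in [set: A]) (W t @^-1` [set (x, b)])).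
    by apply: fin_bigcup_measurable => // b _; exact: mW.
  apply/seteqP; split => [u /= <-|u [b _ /= -> //]].
  by exists (W t u).2 => //=; case: (W t u).
have mW2 t b : measurable ((fun u => (W t u).2) @^-1` [set b]).
  rewrite (_ : _ @^-1` _ = \bigcup_(x in [set: S]) (W t @^-1` [set (x, b)])).
    by apply: fin_bigcup_measurable => // x _; exact: mW.
  apply/seteqP; split => [u /= <-|u [x _ /= -> //]].
  by exists (W t u).1 => //=; case: (W t u).
constructor.
apply: (@Trajectory R S A M pol s _ _ (@unit_unif R)
  (fun t u => (W t u).1) (fun t u => (W t u).2)) => // n x a.
pose w t : T := (x t, a t).
rewrite /= /unit_unif /mrestr (_ : _ `&` _ = slot mu0 K w n.+1).
  rewrite lebesgue_measure_itv/= lte_fin ltrDl -EFinB addrC addKr.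
  have := len_ge0 mu0P KP w n.+1; rewrite le_eqVlt => lenE.
  transitivity (len mu0 K w n.+1)%:E.
    by case: ifPn => // /negPf nlen; move: lenE; rewrite nlen orbF => /eqP <-.
  rewrite len_prod /mu0 /K /= big_ord_recl/= big_split/=; congr (_%:E).
  by rewrite -!mulrA; congr (_ * (_ * _)); rewrite mulrC.
apply/seteqP; split => u.
- case=> Wu /=; rewrite in_itv/= => u01.
  apply/(slot_prefix t0 mu0P KP); split=> // t tn.
  by have := Wu t tn; rewrite /W u01 /w => -[<- <-]; case: walk.
- move/(slot_prefix t0 mu0P KP) => [u01 e]; split; last by rewrite /= in_itv.
  by move=> t tn; rewrite /W u01 e.
Qed.

(* Main.v *)
(* If [tpol] is greedy for [Q^k], optimality of [pol k.+1] in the mirror step and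
   [D >= 0] give [<pol k.+1, Q^k> >= max Q^k - D(tpol, pol k) / eta k], so
   [V k.+1] differs from the optimal Bellman update of [V k] by at most
   [c * gamma ^ (2 k + 1)]; contraction then sums these errors geometrically.
   [D >= 0] needs every iterate to stay in the interior of [dom h], where [h] is
   differentiable: this is where essential smoothness enters. The optimality
   equation for [opt_value] comes from the Bellman equation of each [value],
   obtained by integrating the return over cylinder sets of the trajectory. *)
Require Import Defs.
From mathcomp Require Import all_boot all_order all_algebra.
From mathcomp Require Import all_classical all_reals all_analysis.
From mathcomp Require Import measurable_realfun ring lra.
Set Implicit Arguments.
Unset Strict Implicit.
Unset Printing Implicit Defensive.
Import Order.TTheory GRing.Theory Num.Theory.
Import numFieldTopology.Exports numFieldNormedType.Exports.
Local Open Scope ring_scope.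
Local Open Scope classical_set_scope.

(** * Convexity, Bregman divergences and interior minimizers *)

Section ConvexAnalysis.
Context {R : realType} {n : nat}.
Implicit Types (C M : set 'rV[R]_n) (h : 'rV[R]_n -> \bar R).

Lemma econvex_fine h : proper_fun h -> econvex h ->
  forall x y (t : R), edom h x -> edom h y -> 0 < t < 1 ->
  edom h (t *: x + (1 - t) *: y) /\
  fine (h (t *: x + (1 - t) *: y)) <= t * fine (h x) + (1 - t) * fine (h y).
Proof.
move=> [hN _] hc x y t hx hy t01; have := hc x y t t01.
move: hx hy; rewrite /edom /=.
have := hN x; case: (h x) => [a| |] // _ _.
have := hN y; case: (h y) => [b| |] // _ _.
rewrite -!EFinM -EFinD.
have := hN (t *: x + (1 - t) *: y); case: (h _) => [r| |] // _.
by rewrite lee_fin; split; first exact: ltry.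
Qed.

Lemma grad_sum h (q v : 'rV[R]_n) : differentiable (fine \o h) q ->
  \sum_i grad h q 0 i * v 0 i = 'D_v (fine \o h) q.
Proof.
move=> hd; rewrite deriveE// {2}(row_sum_delta v) linear_sum; apply: eq_bigr => i _.
by rewrite mxE deriveE// linearZ/= mulrC.
Qed.

(** Convexity bounds the difference quotients at [q] in direction [p - q] by [h p - h q] for steps
    in (0, 1); their limit from the right is the directional derivative. *)
Lemma grad_le h : proper_fun h -> econvex h ->
  forall p q, edom h p -> edom h q -> differentiable (fine \o h) q ->
  \sum_i grad h q 0 i * (p - q) 0 i <= fine (h p) - fine (h q).
Proof.
move=> hp hc p q pd qd hd; rewrite grad_sum//.
have /cvg_dnbhs_at_right dq : derivable (fine \o h) q (p - q) by exact: diff_derivable.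
apply: (cvgr_to_le dq).
near=> t.
have t01 : 0 < t < 1 by apply/andP; split; near: t; [exact: nbhs_right_gt|exact: nbhs_right_lt].
have [_] := econvex_fine hp hc pd qd t01.
have /andP[t0 _] := t01.
rewrite /= /GRing.scale/= ler_pdivrMl// lerBlDr.
have -> : t *: p + (1 - t) *: q = t *: (p - q) + q.
  by apply/rowP => i; rewrite !mxE; ring.
by move/le_trans; apply; lra.
Unshelve. all: by end_near.
Qed.

Lemma bregman_ge0 h : proper_fun h -> econvex h ->
  forall p q, edom h p -> edom h q -> differentiable (fine \o h) q ->
  0 <= bregman h p q.
Proof. by move=> hp hc p q pd qd hd; rewrite /bregman subr_ge0 grad_le. Qed.

Lemma continuous_line (V : normedModType R) (x y : V) :
  continuous (fun t : R => (1 - t) *: x + t *: y).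
Proof.
move=> t; apply: cvgD; apply: cvgZ; [|exact: cvg_cst|exact: cvg_id|exact: cvg_cst].
by apply: cvgB; [exact: cvg_cst|exact: cvg_id].
Qed.

(** The continuous map [g] inverts [z |-> t *: z + (1 - t) *: y], so it pulls [C], a neighbourhood
    of [x], back to a neighbourhood of the combination; convexity puts that preimage inside [C]. *)
Lemma interior_segment (V : normedModType R) (C : set V) :
  (forall x y (t : R), C x -> C y -> 0 < t < 1 -> C (t *: x + (1 - t) *: y)) ->
  forall x y t, C° x -> C y -> 0 < t < 1 -> C° (t *: x + (1 - t) *: y).
Proof.
move=> hC x y t Cx Cy t01; have /andP[t0 _] := t01.
pose g (z : V) := t^-1 *: (z - (1 - t) *: y).
have gc : continuous g.
  by move=> z; apply: cvgZl_tmp; apply: cvgB; [exact: cvg_id|exact: cvg_cst].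
have gx : g (t *: x + (1 - t) *: y) = x by rewrite /g addrK scalerK ?gt_eqF.
have gC : nbhs (t *: x + (1 - t) *: y) (g @^-1` C) by apply: gc; rewrite gx.
apply: filterS gC => z Cz.
have -> : z = t *: g z + (1 - t) *: y by rewrite /g scalerKV ?gt_eqF// subrK.
exact: hC.
Qed.

(** Any [y] is an affine combination of [x] and [g (e / 2)], a point between which and [x] the
    distance is small enough for it to lie in [C]. *)
Lemma aff_hull_full C : C° !=set0 -> aff_hull C = setT.
Proof.
move=> [x Cx]; apply/seteqP; split => // y _ M hM CM.
pose g (t : R) := (1 - t) *: x + t *: y.
have gx : g 0 = x by rewrite /g subr0 scale1r scale0r addr0.
have gC : nbhs (g 0) C by rewrite gx.
have : nbhs 0 (g @^-1` C) := continuous_line gC.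
move=> /nbhs_ballP[e /= e0 he].
have Cg : C (g (e / 2)).
  by apply: he; rewrite /ball/= sub0r normrN gtr0_norm ?divr_gt0//; lra.
have -> : y = (1 - (e / 2)^-1) *: x + (e / 2)^-1 *: g (e / 2).
  rewrite /g scalerDr !scalerA mulVf ?lt0r_neq0 ?divr_gt0// scale1r addrA -scalerDl.
  rewrite mulrBr mulr1 mulVf ?lt0r_neq0 ?divr_gt0//.
  by rewrite addrC [X in X *: x](_ : _ = 0) ?scale0r ?addr0//; ring.
by apply: hM; apply: CM => //; exact: interior_subset Cx.
Qed.

Lemma rint_interior C : C° !=set0 -> rint C `<=` C°.
Proof.
move=> C0 x []; rewrite aff_hull_full// => _.
by rewrite /within/= /interior; apply: filterS => y; exact.
Qed.

(* If the minimizer [p] were a boundary point, the slope of [h] along the segment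
   from [p] to [x] would stay bounded below near [p]; the gradient inequality at
   the points [x + u] of a ball around [x] then bounds the gradients on that
   segment, against essential smoothness. *)
Lemma argmin_interior h (g : 'rV[R]_n) (D : set 'rV[R]_n) (x p : 'rV[R]_n) :
  legendre h ->
  (forall t : R, 0 < t < 1 -> D (t *: x + (1 - t) *: p)) ->
  (edom h)° x -> edom h p ->
  (forall y, D y -> fine (h p) - \sum_i g 0 i * p 0 i <= fine (h y) - \sum_i g 0 i * y 0 i) ->
  (edom h)° p.
Proof.
move=> [hp hc [_ hdiff hblow] _] hD xI pd pmin; apply: contrapT => npI.
pose f := fine \o h; pose z t := t *: x + (1 - t) *: p.
pose L := \sum_i g 0 i * (x - p) 0 i.
have segc := econvex_fine hp hc.
have zI t : 0 < t < 1 -> (edom h)° (z t).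
  by apply: interior_segment => // a b s ad bd s01; have [] := segc _ _ _ ad bd s01.
have xd : edom h x := interior_subset xI.
have linz (G : 'rV[R]_n) a t (u : 'rV[R]_n) : \sum_i G 0 i * (a *: u + t *: (x - p)) 0 i =
    a * (\sum_i G 0 i * u 0 i) + t * \sum_i G 0 i * (x - p) 0 i.
  rewrite !mulr_sumr -big_split/=; apply: eq_bigr => i _; rewrite !mxE; ring.
(* Minimality gives the first bound; the gradient inequality from [z t] to [p], divided by [t],
   turns it into the second. *)
have slope t : 0 < t < 1 -> f (z t) >= f p + t * L /\
    L <= \sum_i grad h (z t) 0 i * (x - p) 0 i.
  move=> t01; have /andP[t0 _] := t01.
  have fz : f p + t * L <= f (z t).
    have := pmin _ (hD _ t01); rewrite -/(z t) -lerBrDr -/(f _) => pm.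
    suff gE : \sum_i g 0 i * z t 0 i = t * L + \sum_i g 0 i * p 0 i.
      by move: pm; rewrite gE /f/=; lra.
    rewrite -[X in _ + X]mul1r addrC -linz; apply: eq_bigr => i _.
    by congr (_ * _); rewrite !mxE; ring.
  split=> //.
  have := grad_le hp hc pd (interior_subset (zI _ t01)) (hdiff _ (zI _ t01)).
  have -> : p - z t = 0 *: 0 + (- t) *: (x - p) by apply/rowP => i; rewrite !mxE; ring.
  rewrite linz mul0r add0r => gz; rewrite -(ler_pM2l t0).
  by move: gz fz; rewrite /f/=; lra.
have /differentiable_continuous fc := hdiff x xI.
have : \forall y \near x, f y < f x + 1 /\ edom h y.
  near=> y; split; near: y; last exact: xI.
  by apply: (cvgr_lt _ fc); rewrite ltrDl.
move=> /nbhs_ballP[e /= e0 he].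
(* In the bound for a test vector [u], the lower bound on [f (z t)] contributes [t * L] and the
   derivative along [x - p] contributes [(1 - t) * L]; the sum no longer depends on [t]. *)
pose K := f x + 1 - f p - L.
have gbound t : 0 < t < 1 -> `|grad h (z t)| <= K / (e / 2).
  move=> t01; have [fz Lz] := slope t t01; have /andP[t0 t1] := t01.
  have gu (u : 'rV[R]_n) : `|u| < e -> \sum_i grad h (z t) 0 i * u 0 i <= K.
    move=> ue; have [fy yd] : f (x + u) < f x + 1 /\ edom h (x + u).
      by apply: he; rewrite -ball_normE/= opprD addrA subrr add0r normrN.
    have := grad_le hp hc yd (interior_subset (zI _ t01)) (hdiff _ (zI _ t01)).
    have -> : x + u - z t = 1 *: u + (1 - t) *: (x - p).
      by apply/rowP => i; rewrite !mxE; ring.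
    rewrite linz mul1r => gz.
    have : (1 - t) * L <= (1 - t) * \sum_i grad h (z t) 0 i * (x - p) 0 i.
      by rewrite ler_pM2l ?subr_gt0.
    by move: gz fz fy; rewrite /K /f/=; lra.
  have [->|] := eqVneq `|grad h (z t)| 0.
    rewrite divr_ge0//; last by lra.
    have := gu 0; rewrite normr0 => /(_ e0); apply: le_trans.
    by rewrite big1// => i _; rewrite [X in _ * X]mxE mulr0.
  move=> /mx_norm_neq0[[i0 i]] /= Ni; rewrite /Num.norm/= Ni.
  rewrite (ord1 i0) {i0 Ni}.
  rewrite ler_pdivlMr ?divr_gt0//.
  (* The sup norm is attained at coordinate [i]; testing on a signed unit vector recovers it, and
     the factor [e / 2] keeps that vector in the open ball. *)
  have ge2 (b : R) : `|b| = 1 -> (e / 2) * (b * grad h (z t) 0 i) <= K.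
    move=> b1.
    pose d : 'rV[R]_n := 'e_i.
    have eE (a : R) j : (a *: d) 0 j = a * (j == i)%:R by rewrite !mxE.
    have := gu ((e / 2 * b) *: d).
    have -> : \sum_j grad h (z t) 0 j * (e / 2 * b *: d) 0 j = e / 2 * (b * grad h (z t) 0 i).
      rewrite (bigD1 i)//= big1 => [|j ji].
        by rewrite addr0 eE eqxx mulr1 mulrC mulrA.
      by rewrite eE (negPf ji) !mulr0.
    apply; rewrite normrZ normrM b1 mulr1 gtr0_norm ?divr_gt0//.
    have : `|d| <= 1.
      have [->//|] := eqVneq `|d| 0.
      move=> /mx_norm_neq0[[j k]] /= Nj; rewrite /Num.norm/= Nj mxE.
      by case: (_ && _); rewrite ?normr1 ?normr0.
    by rewrite -(ler_pM2l e0); lra.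
  rewrite mulrC; case: (ger0P (grad h (z t) 0 i)) => _.
    by have := ge2 1; rewrite mul1r; apply; rewrite normr1.
  by have := ge2 (-1); rewrite mulN1r; apply; rewrite normrN1.
(* The first harmonic term is 1; halving keeps every [t i] strictly below 1. *)
pose t (i : nat) : R := harmonic i / 2.
have t01 i : 0 < t i < 1.
  rewrite /t divr_gt0 ?harmonic_gt0//= ltr_pdivrMr// mul1r.
  by rewrite (@le_lt_trans _ _ 1) ?ltr1n// invf_le1// ler1n.
have tz : z (t i) @[i --> \oo] --> p.
  have t0 : t i @[i --> \oo] --> (0 : R).
    by rewrite -[X in _ --> X](mul0r (2^-1)); apply: cvgM; [exact: cvg_harmonic|exact: cvg_cst].
  have -> : (fun i => z (t i)) = (fun s => (1 - s) *: p + s *: x) \o t.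
    by apply/funext => i; rewrite /z/= addrC.
  have := cvg_comp _ _ t0 (@continuous_line 'rV[R]_n p x 0).
  by rewrite subr0 scale1r scale0r addr0.
have /cvgryPgt/(_ (K / (e / 2)))[N _ /(_ N (leqnn N))]/= := hblow _ _ (fun i => zI _ (t01 i)) npI tz.
by rewrite ltNge gbound.
Unshelve. all: by end_near.
Qed.

End ConvexAnalysis.

(** * Integration over the fibres of a finite-valued map *)

Section FiniteFibres.
Context {d : measure_display} {W : measurableType d} {R : realType} {T : finType}.
Variable Z : W -> T.
Hypothesis mZ : forall z, measurable (Z @^-1` [set z]).

Lemma measurable_fun_finite (f : T -> R) : measurable_fun [set: W] (f \o Z).
Proof.
move=> _ B _; rewrite setTI.
rewrite (_ : _ @^-1` _ = \bigcup_(z in [set z | B (f z)]) (Z @^-1` [set z])).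
  by apply: fin_bigcup_measurable => //; exact: finite_finset.
by apply/seteqP; split => [w Bw|w [z Bz /= ->]//]; exists (Z w).
Qed.

Lemma ge0_integral_fibres (mu : {measure set W -> \bar R}) (D : set W) (f : W -> \bar R) :
  measurable D -> measurable_fun D f -> (forall w, D w -> (0 <= f w)%E) ->
  (\int[mu]_(w in D) f w = \sum_(z : T) \int[mu]_(w in D `&` Z @^-1` [set z]) f w)%E.
Proof.
move=> mD mf f0.
have DE : D = \big[setU/set0]_(z <- index_enum T) (D `&` Z @^-1` [set z]).
  rewrite -bigcup_seq; apply/seteqP; split => [w Dw|w [z _ []]//].
  by exists (Z w) => //=; rewrite mem_index_enum.
rewrite {1}DE ge0_integral_bigsetU//.
- by move=> z; exact: measurableI.
- exact: index_enum_uniq.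
- by move=> x y _ _ [w [[_ <-] [_ <-]]].
- by rewrite -DE.
- by move=> w; rewrite -DE; exact: f0.
Qed.

End FiniteFibres.

Section SimplexAverage.
Context {R : realType} {T : finType}.
Implicit Types p f g : T -> R.

Lemma le_dotf p f g : simplex R T p -> (forall x, f x <= g x) -> dotf p f <= dotf p g.
Proof. by move=> [p0 _] fg; apply: ler_sum => x _; rewrite ler_wpM2l. Qed.

Lemma dotf_cst p c : simplex R T p -> dotf p (fun=> c) = c.
Proof. by move=> [_ p1]; rewrite /dotf -mulr_suml p1 mul1r. Qed.

Lemma dotf_le p f c : simplex R T p -> (forall x, f x <= c) -> dotf p f <= c.
Proof. by move=> ps fc; rewrite -[leRHS](dotf_cst c ps); exact: le_dotf. Qed.

End SimplexAverage.

(** * Finite-horizon returns and their limit, the value *)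

Section Value.
Context {R : realType} {S A : finType}.
Variable M : mdp R S A.
Implicit Types (pol : policy R S A) (V : S -> R).

Lemma bellman_qfun pol V s : bellman M pol V s = dotf (pol s) (qfun M V s).
Proof.
apply: eq_bigr => a _; congr (_ * _); rewrite /qfun.
have [_ t1] := transP M s a.
under eq_bigr do rewrite mulrDr; rewrite big_split/= -mulr_suml t1 mul1r.
by congr (_ + _); rewrite mulr_sumr; apply: eq_bigr => s' _; rewrite mulrCA.
Qed.

Section Trajectory.
Variables (pol : policy R S A) (s : S) (X : trajectory M pol s).
Local Notation P := (traj_prob X).

Let Z t (w : traj_space X) := (traj_state t w, traj_action t w).
Let rew (z : S * A) := reward M z.1 z.2.
(** [J m] is the expected [m]-step discounted return from a state, and [U m] the one from a
    state-action pair. *)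
Let J m := iter m (bellman M pol) (fun=> 0).
Let U m (z : S * A) := if m is m'.+1 then qfun M (J m') z.1 z.2 else 0.

Let cyl n (x : nat -> S * A) := [set w : traj_space X | forall t, (t <= n)%N -> Z t w = x t].
Let law n (x : nat -> S * A) := ((x 0%N).1 == s)%:R * \prod_(t < n.+1) pol (x t).1 (x t).2 *
 \prod_(t < n) trans M (x t).1 (x t).2 (x t.+1).1.
(** Discounting restarts at time [j], so peeling off one reward leaves a single factor [gamma M]. *)
Let G j m (w : traj_space X) := \sum_(t < m) gamma M ^+ t * rew (Z (j + t)%N w).

Lemma measurable_fibre t z : measurable (Z t @^-1` [set z]).
Proof.
rewrite (_ : _ @^-1` _ =
    traj_state t @^-1` [set z.1] `&` traj_action t @^-1` [set z.2]).
  by apply: measurableI; [exact: traj_state_measurable|exact: traj_action_measurable].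
by case: z => x a; apply/seteqP; split => w /= [e1 e2]; [split|rewrite /Z e1 e2].
Qed.

Lemma cyl_law n x : P (cyl n x) = (law n x)%:E.
Proof.
rewrite /law -(traj_law X n (fun t => (x t).1) (fun t => (x t).2)); congr (P _).
apply/seteqP; split => w /= hw t tn; first by rewrite -(hw t tn).
by have [e1 e2] := hw t tn; rewrite /Z e1 e2 -surjective_pairing.
Qed.

Lemma lawS n x : law n.+1 x =
  law n x * trans M (x n).1 (x n).2 (x n.+1).1 * pol (x n.+1).1 (x n.+1).2.
Proof. by rewrite /law big_ord_recr [X in _ * X]big_ord_recr/=; ring. Qed.

Lemma law_ext n x y : (forall t, (t <= n)%N -> x t = y t) -> law n x = law n y.
Proof.
move=> xy; rewrite /law xy//; congr (_ * _ * _); apply: eq_bigr => -[i /= ilt] _.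
  by rewrite xy.
by rewrite !xy// ltnW.
Qed.

Lemma measurable_cyl n x : measurable (cyl n x).
Proof.
rewrite (_ : cyl n x = \bigcap_(t in [set t | (t <= n)%N]) (Z t @^-1` [set x t])) //.
apply: bigcap_measurable; first by exists 0%N.
by move=> t _; exact: measurable_fibre.
Qed.

Lemma rew_ge0 z : 0 <= rew z.
Proof. by have /andP[] := reward01 M z.1 z.2. Qed.

Lemma measurable_G j m : measurable_fun setT (G j m).
Proof.
apply: measurable_sum => t; apply: measurable_funM => //.
exact/measurable_fun_finite/measurable_fibre.
Qed.

Lemma G_ge0 j m w : 0 <= G j m w.
Proof.
have /andP[g0 _] := gamma01 M.
by apply: sumr_ge0 => t _; rewrite mulr_ge0 ?exprn_ge0 ?rew_ge0// ltW.
Qed.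

Lemma GS j m w : G j m.+1 w = rew (Z j w) + gamma M * G j.+1 m w.
Proof.
rewrite /G big_ord_recl expr0 mul1r addn0 mulr_sumr; congr (_ + _).
by apply: eq_bigr => t _; rewrite /bump/= exprS -mulrA addnS addSn.
Qed.

Lemma J_pol m y : \sum_b pol y b * U m (y, b) = J m y.
Proof.
case: m => [|m]; first by rewrite big1// => b _; rewrite mulr0.
by rewrite /J iterS bellman_qfun.
Qed.

(** The bound is the fixed point of [v |-> 1 + gamma M * v]. *)
Lemma J_le m y : J m y <= (1 - gamma M)^-1.
Proof.
have /andP[g0 g1] := gamma01 M.
elim: m y => [|m IH] y; first by rewrite invr_ge0 subr_ge0 ltW.
rewrite /J iterS bellman_qfun; apply: dotf_le; first exact: policyP.
move=> a; rewrite /qfun; have /andP[_ r1] := reward01 M y a.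
apply: (@le_trans _ _ (1 + gamma M * (1 - gamma M)^-1)).
  rewrite lerD// ler_pM2l//; apply: dotf_le; [exact: transP|exact: IH].
by rewrite le_eqVlt; apply/orP; left; apply/eqP; field; lra.
Qed.

(* Conditionally on the first [j] steps the remaining return only depends on the
   current state-action pair. *)
Lemma integral_cyl m j x :
  (\int[P]_(w in cyl j x) (G j m w)%:E = (law j x * U m (x j))%:E)%E.
Proof.
elim: m j x => [|m IH] j x.
  rewrite mulr0 integral0_eq// => w _; by rewrite /G big_ord0.
have mc := measurable_cyl j x.
have /andP[g0 _] := gamma01 M.
have mG i k D : measurable_fun D (EFin \o G i k).
  by apply/measurable_EFinP; apply: measurable_funTS; exact: measurable_G.
transitivity (\int[P]_(w in cyl j x) ((rew (x j))%:E + (gamma M)%:E * (G j.+1 m w)%:E))%E.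
  by apply: eq_integral => w; rewrite inE GS => ->.
rewrite ge0_integralD//; last first.
- by apply: measurable_funeM; exact: mG.
- by move=> w _; rewrite mule_ge0 ?lee_fin ?G_ge0// ltW.
- by move=> w _; rewrite lee_fin rew_ge0.
rewrite integral_cst// [X in (_ * X + _)%E](cyl_law j x) ge0_integralZl_EFin//; last first.
- exact: ltW.
- exact: mG.
- by move=> w _; rewrite lee_fin G_ge0.
rewrite (ge0_integral_fibres (measurable_fibre j.+1))//; last first.
- by move=> w _; rewrite lee_fin G_ge0.
- exact: mG.
(* [y z] follows [x] up to time [j], then equals [z]: the cylinder of [x] cut by a fibre at time
   [j.+1] is the cylinder of [y z]. *)
pose y z t := if (t <= j)%N then x t else z.
under eq_bigr => z _.
  rewrite (_ : cyl j x `&` _ = cyl j.+1 (y z)); last first.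
    apply/seteqP; split => w.
      move=> [/= xw zw] t; rewrite leq_eqVlt ltnS /y => /predU1P[->|tj].
        by rewrite ltnn.
      by rewrite tj; exact: xw.
    move=> yw; split => [t tj|/=]; last by rewrite (yw j.+1)// /y ltnn.
    by rewrite yw ?leqW// /y tj.
  rewrite IH.
  over.
rewrite sumEFin -!EFinM -EFinD; congr (_%:E).
rewrite /= /qfun -/(rew _) mulrDr mulrC; congr (_ + _).
rewrite mulrCA; congr (_ * _).
transitivity (\sum_y' \sum_b law j.+1 (y (y', b)) * U m (y (y', b) j.+1)).
  by rewrite pair_bigA; apply: eq_bigr => -[].
rewrite mulr_sumr.
apply: eq_bigr => y' _; rewrite -J_pol !mulr_sumr; apply: eq_bigr => b _.
rewrite lawS (@law_ext j _ x) => [|t tj]; last by rewrite /y tj.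
by rewrite /y leqnn ltnn/=; ring.
Qed.

Lemma integral_return m : (\int[P]_w (G 0 m w)%:E = (J m s)%:E)%E.
Proof.
rewrite (ge0_integral_fibres (measurable_fibre 0))//; last first.
- by move=> w _; rewrite lee_fin G_ge0.
- by apply/measurable_EFinP; exact: measurable_G.
under eq_bigr => z _.
  rewrite setTI (_ : _ @^-1` _ = cyl 0 (fun=> z)); last first.
    by apply/seteqP; split => w /= zw; [case=> //|exact: zw].
  rewrite integral_cyl /law big_ord0 big_ord1 mulr1.
  over.
rewrite sumEFin; congr (_%:E).
transitivity (\sum_y \sum_b (y == s)%:R * pol y b * U m (y, b)).
  by rewrite pair_bigA; apply: eq_bigr => -[].
rewrite (bigD1 s)//=.
rewrite [X in _ + X]big1 ?addr0 => [|y /negPf ys].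
  by rewrite -J_pol; apply: eq_bigr => b _; rewrite eqxx mul1r.
by rewrite big1// => b _; rewrite ys !mul0r.
Qed.

(** Rewards are nonnegative, so the truncated returns increase to the full return and monotone
    convergence applies to [integral_return]. *)
Lemma cvg_value : J m s @[m --> \oo] --> value X.
Proof.
have /andP[g0 g1] := gamma01 M.
pose u (w : traj_space X) t := gamma M ^+ t * rew (Z t w).
have u0 w t : 0 <= u w t by rewrite mulr_ge0 ?exprn_ge0 ?rew_ge0// ltW.
have Gu w : series (u w) = G 0 ^~ w.
  by apply/funext => m; rewrite /series/= big_mkord.
have ug w t : u w t <= geometric 1 (gamma M) t.
  rewrite /geometric/= mul1r ler_piMr ?exprn_ge0//; first exact: ltW.
  by have /andP[] := reward01 M (Z t w).1 (Z t w).2.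
have cg : series (geometric 1 (gamma M)) @ \oo --> 1 / (1 - gamma M).
  by apply: cvg_geometric_series; rewrite gtr0_norm.
have cu w : cvgn (series (u w)).
  apply: (series_le_cvg (u0 w) _ (ug w)); last by apply/cvg_ex; eexists; exact: cg.
  by move=> t; rewrite /geometric/= mul1r exprn_ge0// ltW.
have EX : ('E_P[@discounted_return _ _ _ _ _ _ X] =
    \int[P]_w limn (fun m => (G 0 m w)%:E))%E.
  rewrite unlock; apply: eq_integral => w _.
  rewrite /discounted_return -/(u w) -EFin_lim//; congr (limn _).
  by apply/funext => m /=; rewrite Gu.
have mono := @cvg_monotone_convergence _ _ _ P setT measurableT (fun m w => (G 0 m w)%:E).
have {mono} : (\int[P]_w (G 0 m w)%:E)%E @[m --> \oo] --> ('E_P[@discounted_return _ _ _ _ _ _ X])%E.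
  rewrite EX; apply: mono.
  - by move=> m; apply/measurable_EFinP; exact: measurable_G.
  - by move=> m w _; rewrite lee_fin G_ge0.
  - move=> w _ m n mn; have GuE k : G 0 k w = series (u w) k by rewrite Gu.
    rewrite lee_fin !GuE.
    exact: (@nondecreasing_series R (u w) xpredT 0 (fun i _ _ => u0 w i) m n mn).
have -> : (fun m => \int[P]_w (G 0 m w)%:E)%E = EFin \o (fun m => J m s).
  by apply/funext => m; rewrite integral_return.
(* [fine] would send an infinite expectation to 0; the uniform bound [J_le] excludes this. *)
move=> cE; have Efin : ('E_P[@discounted_return _ _ _ _ _ _ X])%E \is a fin_num.
  have cE' : cvgn (EFin \o (fun m => J m s)) by apply/cvg_ex; eexists; exact: cE.
  rewrite -(cvg_lim _ cE)// ge0_fin_numE; last first.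
    apply: lime_ge => //; apply: nearW => m.
    by rewrite /= -integral_return integral_ge0// => w _; rewrite lee_fin G_ge0.
  apply: (@le_lt_trans _ _ (1 - gamma M)^-1%:E); last exact: ltry.
  apply: lime_le => //.
  by apply: nearW => m; rewrite lee_fin J_le.
by rewrite /value; move: cE; rewrite -(fineK Efin) => /fine_cvg.
Qed.

End Trajectory.

(** * Bellman equation, comparison and optimality equation *)

Lemma value_bellman pol (X : forall s, trajectory M pol s) s :
  bellman M pol (fun y => value (X y)) s = value (X s).
Proof.
(* [J m.+1 s] has two limits to be identified: one as a shifted sequence, one as the Bellman image
   of [J m], the operator being a finite sum. *)
pose J m := iter m (bellman M pol) (fun=> 0).
have JS : J m.+1 s @[m --> \oo] --> value (X s).
  by have := @cvg_value pol s (X s); rewrite -(cvg_shiftS (fun m => J m s)).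
have JB : J m.+1 s @[m --> \oo] --> bellman M pol (fun y => value (X y)) s.
  apply: cvg_big => [|a _]; first exact: add_continuous.
  apply: cvgM; first exact: cvg_cst.
  apply: cvg_big => [|y _]; first exact: add_continuous.
  apply: cvgM; first exact: cvg_cst.
  apply: cvgD; first exact: cvg_cst.
  by apply: cvgM; [exact: cvg_cst|exact: cvg_value].
by rewrite -(cvg_lim _ JS)//; rewrite (cvg_lim _ JB).
Qed.

(** One-sided form of both monotonicity and contraction: a constant passes through the averages and
    is discounted once. *)
Lemma bellman_shift pol V W c : (forall s, W s <= V s + c) ->
  forall s, bellman M pol W s <= bellman M pol V s + gamma M * c.
Proof.
have /andP[g0 _] := gamma01 M => WV s.
rewrite !bellman_qfun -[X in _ + X](dotf_cst _ (policyP pol s)) -big_split/=.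
apply: ler_sum => a _; rewrite -mulrDr ler_wpM2l//; first by have [] := policyP pol s.
rewrite /qfun -addrA lerD2l -mulrDr ler_pM2l//.
rewrite -[X in _ + X](dotf_cst _ (transP M s a)) -big_split/=.
apply: ler_sum => y _; rewrite -mulrDr ler_wpM2l//; by have [] := transP M s a.
Qed.

(** At a state maximizing [W - V], the maximal gap is at most [gamma M] times itself, hence
    nonpositive. *)
Lemma bellman_comparison pol V W : (forall s, W s <= bellman M pol W s) ->
  (forall s, bellman M pol V s <= V s) -> forall s, W s <= V s.
Proof.
move=> hW hV s; have /andP[_ g1] := gamma01 M.
case: (@arg_maxP _ _ _ s predT (fun y => W y - V y)) => // y _ ymax.
have WV z : W z <= V z + (W y - V y) by have := ymax z isT; rewrite /=; lra.
have := bellman_shift pol WV y; have := hW y; have := hV y; have := WV s.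
nra.
Qed.

Lemma le_bellman pol V W : (forall s, W s <= V s) ->
  forall s, bellman M pol W s <= bellman M pol V s.
Proof.
move=> WV s; rewrite -[leRHS]addr0 -(mulr0 (gamma M)).
by apply: bellman_shift => y; rewrite addr0.
Qed.

Lemma det_policyP (d : S -> A) s : simplex R A (fun a => (a == d s)%:R).
Proof.
split=> [a|]; first by rewrite ler0n.
by rewrite (bigD1 (d s))//= eqxx big1 ?addr0// => a /negPf ->.
Qed.

Definition det_policy (d : S -> A) : policy R S A := Policy (det_policyP d).

Lemma bellman_det d V s : bellman M (det_policy d) V s = qfun M V s (d s).
Proof.
rewrite bellman_qfun /dotf (bigD1 (d s))//= eqxx mul1r big1 ?addr0// => a /negPf ->.
by rewrite mul0r.
Qed.

(* The deterministic policy with the largest total value cannot be improved by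
   its greedy policy, so its value solves the optimality equation. *)
Lemma opt_value_bellman (X : forall pol s, trajectory M pol s) : (0 < #|A|)%N ->
  (forall pol s, bellman M pol (opt_value X) s <= opt_value X s) /\
  exists pol, forall s, bellman M pol (opt_value X) s = opt_value X s.
Proof.
move=> /card_gt0P[a0 _].
pose val (d : {ffun S -> A}) s := value (X (det_policy d) s).
case: (@arg_maxP _ _ _ [ffun=> a0] predT (fun d => \sum_s val d s)) => // D _ Dmax.
pose W := val D.
pose d' : {ffun S -> A} := [ffun s => [arg max_(a > a0) qfun M W s a]%O].
have greedy pol s : bellman M pol W s <= bellman M (det_policy d') W s.
  rewrite bellman_det bellman_qfun; apply: dotf_le; first exact: policyP.
  by move=> a; rewrite /d' ffunE; case: arg_maxP => // b _; apply.
have WE s : bellman M (det_policy D) W s = W s by exact: value_bellman.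
have Wd' s : W s <= bellman M (det_policy d') W s by rewrite -[leLHS]WE.
have d'E s : bellman M (det_policy d') (val d') s = val d' s by exact: value_bellman.
have Wval : forall s, W s <= val d' s.
  by apply: (bellman_comparison Wd') => s; rewrite d'E.
(* [val d'] dominates [W] at each state but has no larger sum, so the nonnegative differences all
   vanish. *)
have valW s : val d' s = W s.
  apply/eqP; rewrite -subr_eq0; apply/eqP.
  apply: (psumr_eq0P (P := predT) (F := fun s => val d' s - W s)) => // [y _|].
    by rewrite subr_ge0.
  apply: le_anti; rewrite sumr_ge0 => [|y _]; last by rewrite subr_ge0.
  by rewrite andbT sumrB subr_le0; exact: Dmax.
have opt pol s : bellman M pol W s <= W s.
  by rewrite (le_trans (greedy _ _))// -[leRHS]valW -d'E; exact: le_bellman.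
(* By comparison with [opt], the value of every policy, randomized or not, is at most [W];
   [det_policy D] attains it. *)
have Wopt : opt_value X = W.
  apply/funext => s; apply/eqP; rewrite eq_le; apply/andP; split.
    apply: ge_sup; first by exists (W s); exists (det_policy D).
    move=> _ [pol _ <-]; apply: (@bellman_comparison pol W (fun y => value (X pol y))) => y.
      by rewrite value_bellman.
    exact: opt.
  apply: ub_le_sup; last by exists (det_policy D).
  exists (W s) => _ [pol _ <-].
  apply: (@bellman_comparison pol W (fun y => value (X pol y))) => y; last exact: opt.
  by rewrite value_bellman.
by rewrite Wopt; split => //; exists (det_policy D).
Qed.

End Value.

(** * Finite maxima and max norms *)

Section FiniteMax.
Context {R : realType} {T : finType}.
Implicit Types f : T -> R.

Lemma le_maxf f x : f x <= maxf f.
Proof.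
apply: ub_le_sup; last by exists x.
exists (\sum_y `|f y|) => _ [y _ <-]; rewrite (le_trans (ler_norm _))//.
by rewrite (bigD1 y)//= lerDl sumr_ge0.
Qed.

Lemma maxf_le f c : (0 < #|T|)%N -> (forall x, f x <= c) -> maxf f <= c.
Proof.
move=> /card_gt0P[x0 _] fc; apply: ge_sup; first by exists (f x0); exists x0.
by move=> _ [x _ <-].
Qed.

Lemma le_maxnorm f x : `|f x| <= maxnorm f.
Proof. exact: (le_maxf (fun y => `|f y|)). Qed.

Lemma maxnorm_dist f g x (N := maxnorm (fun y => f y - g y)) :
  f x <= g x + N /\ g x <= f x + N.
Proof.
have := le_maxnorm (fun y => f y - g y) x; rewrite -/N /= ler_norml => /andP[? ?].
by split; lra.
Qed.

Lemma sum_vec f g : \sum_i vec f 0 i * vec g 0 i = dotf f g.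
Proof.
rewrite /dotf (reindex _ (onW_bij _ (@enum_val_bij T))).
by apply: eq_bigr => i _; rewrite !mxE.
Qed.

End FiniteMax.

(** * The mirror step *)

Section MirrorDescent.
Context {R : realType} {A : finType} (h : 'rV[R]_#|A| -> \bar R).
Hypothesis hh : mirror_map h.

Lemma mirror_edom (p : A -> R) : simplex R A p -> edom h (vec p).
Proof. by move=> ps; have [_ sub _] := hh; apply: sub; exists p. Qed.

Lemma mirror_rint x : rint (edom h) x -> (edom h)° x.
Proof. by have [[_ _ [i0 _ _] _] _ _] := hh; exact: rint_interior. Qed.

Lemma mirror_bregman_ge0 (p q : A -> R) : simplex R A p -> (edom h)° (vec q) ->
  0 <= bregman h (vec p) (vec q).
Proof.
have [[hp hc [_ hd _] _] _ _] := hh => ps qi.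
by apply: bregman_ge0 => //; [exact: mirror_edom|exact: interior_subset|exact: hd].
Qed.

(** Up to a constant, the step minimizes [h] minus the linear form of
    [grad h (vec q) + eta *: vec Q]; [argmin_interior] applies along the segment to a simplex point
    of [rint (edom h)]. *)
Lemma mirror_step_interior (eta : R) (Q p q : A -> R) :
  is_argmax (simplex R A)
    (fun p => eta * dotf p Q - bregman h (vec p) (vec q)) p ->
  (edom h)° (vec p).
Proof.
move=> [ps pmax]; have [hl _ [z [zi [x xs xz]]]] := hh.
rewrite -{}xz in zi.
have seg (t : R) : 0 < t < 1 ->
    (vec @` simplex R A) (t *: vec x + (1 - t) *: vec p).
  move=> /andP[t0 t1]; exists (fun a => t * x a + (1 - t) * p a).
    case: xs ps => [x0 x1] [p0 p1]; split => [a|].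
      by rewrite addr_ge0// mulr_ge0// ?subr_ge0 ltW.
    by rewrite big_split/= -!mulr_sumr x1 p1 !mulr1 addrC subrK.
  by apply/rowP => i; rewrite !mxE.
apply: (argmin_interior (g := grad h (vec q) + eta *: vec Q) hl seg).
- exact: mirror_rint.
- exact: mirror_edom.
move=> _ [y ys <-]; have := pmax y ys; rewrite /bregman.
have sumE (r : A -> R) : \sum_i (grad h (vec q) + eta *: vec Q) 0 i * vec r 0 i =
    \sum_i grad h (vec q) 0 i * (vec r - vec q) 0 i +
    \sum_i grad h (vec q) 0 i * vec q 0 i + eta * dotf r Q.
  rewrite -sum_vec mulr_sumr -!big_split/=; apply: eq_bigr => i _.
  by move: (grad h _) => G; rewrite !mxE; ring.
by rewrite !sumE; lra.
Qed.

End MirrorDescent.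

(** * One-step error and policy loss *)

Section Convergence.
Context {R : realType} {S A : finType}.
Variables (M : mdp R S A) (X : forall (p : policy R S A) (s : S), trajectory M p s).
Hypotheses (hS : (0 < #|S|)%N) (hA : (0 < #|A|)%N).

Lemma pmd_interior h eta pol V : mirror_map h -> td_pmd M h eta pol V ->
  forall k s, (edom h)° (vec (pol k s)).
Proof.
move=> hh hpmd [|k] s; first by apply: mirror_rint => //; exact: (pmd_init hpmd).
exact: mirror_step_interior (pmd_policy hpmd k s).
Qed.

(** Compared with [tpol] in the mirror step, and with its own nonnegative divergence dropped,
    [pol k.+1] loses at most the divergence of [tpol], which is at most [eta k * e]. *)
Lemma pmd_improvement h eta pol V (tpol : policy R S A) k s (e : R) :
  mirror_map h -> td_pmd M h eta pol V ->
  dotf (tpol s) (qfun M (V k) s) = maxf (qfun M (V k) s) ->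
  0 < e -> maxf (policy_div h tpol (pol k)) / e <= eta k ->
  maxf (qfun M (V k) s) <= bellman M (pol k.+1) (V k) s + e.
Proof.
move=> hh hpmd <- e0; rewrite ler_pdivrMr// => /(le_trans (le_maxf _ s)) De.
have [_ /(_ _ (policyP tpol s)) /=] := pmd_policy hpmd k s.
have := mirror_bregman_ge0 hh (policyP (pol k.+1) s) (pmd_interior hh hpmd k s).
rewrite bellman_qfun => ? ?; rewrite -(ler_pM2l (pmd_step hpmd k)) mulrDr.
by move: De; rewrite /policy_div; lra.
Qed.

(** Only the upper side costs [e]: there an optimal policy's update of [V] is below [maxf]. On the
    lower side, updating the optimal value by [p] cannot raise it. *)
Lemma opt_value_step (V V' : S -> R) (p : policy R S A) (e : R) :
  (forall s, V' s = bellman M p V s) -> 0 <= e ->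
  (forall s, maxf (qfun M V s) <= V' s + e) ->
  maxnorm (fun s => opt_value X s - V' s)
    <= gamma M * maxnorm (fun s => opt_value X s - V s) + e.
Proof.
move=> V'E e0 maxV; have [opt [d dE]] := opt_value_bellman X hA.
apply: maxf_le => // s; rewrite ler_norml.
set N := maxnorm _.
have lo y : opt_value X y <= V y + N.
  by have [] := maxnorm_dist (opt_value X) V y.
have hi y : V y <= opt_value X y + N.
  by have [] := maxnorm_dist (opt_value X) V y.
have dV : bellman M d V s <= maxf (qfun M V s).
  by rewrite bellman_qfun; apply: dotf_le; [exact: policyP|exact: le_maxf].
have := bellman_shift M d lo s; have := bellman_shift M p hi s.
have := opt p s; have := maxV s; rewrite dE V'E.
by move=> *; apply/andP; split; lra.
Qed.

(** [V'] and the value of [p] are images of [V] and of that value under the same contraction; the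
    triangle inequality through the optimal value leaves a term [gamma M * N], absorbed on the
    left. *)
Lemma policy_loss (V V' : S -> R) (p : policy R S A) :
  (forall s, V' s = bellman M p V s) ->
  (1 - gamma M) * maxnorm (fun s => opt_value X s - value (X p s))
    <= maxnorm (fun s => opt_value X s - V' s)
       + gamma M * maxnorm (fun s => opt_value X s - V s).
Proof.
move=> V'E; have /andP[g0 _] := gamma01 M.
set N := maxnorm (fun s => _ - value _); set NV := maxnorm (fun s => _ - V s).
rewrite mulrBl mul1r lerBlDr; apply: maxf_le => // s; rewrite ler_norml.
have hN y := maxnorm_dist (opt_value X) (fun s => value (X p s)) y.
have hV y := maxnorm_dist (opt_value X) V y.
have lo y : value (X p y) <= V y + (N + NV).
  by have [] := hN y; have [] := hV y; rewrite -/NV /= -/N; lra.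
have hi y : V y <= value (X p y) + (N + NV).
  by have [] := hN y; have [] := hV y; rewrite -/NV /= -/N; lra.
have := bellman_shift M p lo s; have := bellman_shift M p hi s.
have := maxnorm_dist (opt_value X) V' s.
rewrite (value_bellman (X p)) -V'E => -[? ?].
by move=> *; apply/andP; split; lra.
Qed.

End Convergence.

Theorem theorem3p9 (R : realType) (S A : finType)
    (hS : (0 < #|S|)%N) (hA : (0 < #|A|)%N)
    (M : mdp R S A) (X : forall (p : policy R S A) (s : S), trajectory M p s)
    (h : 'rV[R]_#|A| -> \bar R) (hh : mirror_map h)
    (eta : nat -> R) (pol : nat -> policy R S A) (V : nat -> S -> R)
    (hpmd : td_pmd M h eta pol V)
    (tpol : nat -> policy R S A)
    (htpol : forall k s,
      dotf (tpol k s) (qfun M (V k) s) = maxf (qfun M (V k) s))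
    (c : R) (hc : 0 < c)
    (heta : forall k,
      maxf (policy_div h (tpol k) (pol k)) / (c * gamma M ^+ (2 * k + 1))
        <= eta k)
    (T : nat) (hT : (0 < T)%N) :
  maxnorm (fun s => opt_value X s - V T s)
    <= gamma M ^+ T *
       (maxnorm (fun s => opt_value X s - V 0%N s) + c / (1 - gamma M))
  /\
  maxnorm (fun s => opt_value X s - value (X (pol T) s))
    <= 2 * gamma M ^+ (T - 1) / (1 - gamma M) *
       (maxnorm (fun s => opt_value X s - V 0%N s) + c / (1 - gamma M)).
Proof.
have /andP[g0 g1] := gamma01 M.
pose B := maxnorm (fun s => opt_value X s - V 0%N s).
pose N k := maxnorm (fun s => opt_value X s - V k s).
have N_step k : N k.+1 <= gamma M * N k + c * gamma M ^+ (2 * k + 1).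
  have e0 : 0 < c * gamma M ^+ (2 * k + 1) by rewrite mulr_gt0// exprn_gt0.
  apply: (opt_value_step X hS hA (pmd_value hpmd k) (ltW e0)) => s.
  rewrite (pmd_value hpmd).
  exact: (pmd_improvement hh hpmd (htpol k s) e0 (heta k)).
(* Divided by [gamma M ^+ k.+1], the recursion has increments [c * gamma M ^+ k]; keeping their
   exact partial sum lets the induction close with equality. *)
have N_geom k : N k <= gamma M ^+ k * (B + c * (1 - gamma M ^+ k) / (1 - gamma M)).
  elim: k => [|k IH]; first by rewrite expr0 subrr mulr0 mul0r addr0 mul1r.
  apply: (le_trans (N_step k)).
  apply: (@le_trans _ _ (gamma M *
    (gamma M ^+ k * (B + c * (1 - gamma M ^+ k) / (1 - gamma M)))
      + c * gamma M ^+ (2 * k + 1))); first by rewrite lerD2r ler_pM2l.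
  rewrite le_eqVlt; apply/orP; left; apply/eqP.
  rewrite exprS exprD expr1 mulnC exprM expr2.
  by field; rewrite subr_eq0 gt_eqF.
have N_le k : N k <= gamma M ^+ k * (B + c / (1 - gamma M)).
  apply: (le_trans (N_geom k)); rewrite ler_pM2l ?exprn_gt0// lerD2l.
  by rewrite ler_pM2r ?invr_gt0 ?subr_gt0// ler_piMr ?(ltW hc)// gerBl exprn_ge0// ltW.
split; first exact: N_le.
case: T hT => // t _; rewrite subn1/=.
have := policy_loss X hS (pmd_value hpmd t).
rewrite -/(N t) -/(N t.+1) => loss.
rewrite mulrAC ler_pdivlMr ?subr_gt0// [leLHS]mulrC (le_trans loss)//.
have b0 : 0 <= B + c / (1 - gamma M).
  have := N_le 0%N; rewrite expr0 mul1r; apply: le_trans.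
  have [s0 _] := card_gt0P hS; exact: le_trans (normr_ge0 _) (le_maxnorm _ s0).
have Nt : gamma M * N t <= gamma M * (gamma M ^+ t * (B + c / (1 - gamma M))).
  by rewrite ler_pM2l.
have Nt1 := N_le t.+1; rewrite exprS in Nt1.
(* Both terms of the loss are at most this left side; one factor [gamma M] is given up to reach the
   exponent [T - 1], and the two terms give the constant 2. *)
have tb : gamma M * (gamma M ^+ t * (B + c / (1 - gamma M))) <=
    gamma M ^+ t * (B + c / (1 - gamma M)).
  by rewrite ler_piMl ?mulr_ge0 ?exprn_ge0// ltW.
by rewrite -/B; lra.
Qed.
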